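(* Let $a<b$ be real numbers and let $f:[a,b]\to\mathbb{R}$ and $\phi,\Phi:[0,b-a]\to\mathbb{R}_+$. Let $x_i\in(a,b)$ for $i=1,\dots,n$, let $\nu_n\ge 1$ and $\nu_i\le 0$ for $i=1,\dots,n-1$, and let $\sum_{i=1}^n \nu_i x_i\in(a,b)$. Then: (a) If $f$ is $\phi$-convex with error function $\phi$, then $$f\left(\sum_{i=1}^n\nu_i x_i\right)\ \ge\ \sum_{i=1}^n\nu_i f(x_i)-\phi\left(\left|\sum_{i=1}^n\nu_i x_i-x_n\right|\right)+\sum_{i=1}^{n-1}\nu_i\,\phi\left(|x_i-x_n|\right).$$ In the special case $n=2$, with $\nu_1=1-\nu$ and $\nu_2=\nu$, this gives $$(1-\nu)f(x_1)+\nu f(x_2)\ \le\ f\big((1-\nu)x_1+\nu x_2\big)-(1-\nu)\,\phi\left(|x_1-x_2|\right)+\phi\left((\nu-1)|x_1-x_2|\right).$$ (b) If $f$ is uniformly convex with modulus $\Phi$, then $$f\left(\sum_{i=1}^n\nu_i x_i\right)\ \ge\ \sum_{i=1}^n\nu_i f(x_i)+\Phi\left(\left|\sum_{i=1}^n\nu_i x_i-x_n\right|\right)-\sum_{i=1}^{n-1}\nu_i\,\Phi\left(|x_i-x_n|\right).$$ In the special case $n=2$, $$f(\nu_1x_1+\nu_2x_2)\ \ge\ \nu_1f(x_1)+\nu_2f(x_2)-\frac{\nu_1}{\nu_2}\,\Phi\left(\nu_2|x_2-x_1|\right).$$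
   Context: $\mathbb{R}_+=[0,\infty)$, $n$ is a positive integer, and $\nu_1,\dots,\nu_n$ are real numbers. A function $f:[a,b]\to\mathbb{R}$ is $\phi$-convex with (non-negative) error function $\phi:[0,b-a]\to\mathbb{R}_+$ if for all $x,y\in[a,b]$ and $t\in[0,1]$, $$tf(x)+(1-t)f(y)+t\,\phi\big((1-t)|x-y|\big)+(1-t)\,\phi\big(t|x-y|\big)\ \ge\ f\big(tx+(1-t)y\big).$$ A function $f:[a,b]\to\mathbb{R}$ is uniformly convex with modulus $\Phi:[0,b-a]\to\mathbb{R}_+$ if for all $x,y\in[a,b]$ and $t\in[0,1]$, $$tf(x)+(1-t)f(y)\ \ge\ f\big(tx+(1-t)y\big)+t(1-t)\,\Phi\big(|x-y|\big).$$
   Formalization: The weights are additionally assumed to satisfy ν_1+…+ν_n=1 (also ν_1+ν_2=1 in the special case of (b)); without this the claim is false, e.g. n=1, ν_1=2, x_1=1, [a,b]=[0,4], f=1, φ=Φ=0 gives 1≥2. *)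

(* Defs.v *)
From mathcomp Require Import all_boot all_order all_algebra.
From mathcomp Require Import reals.

Set Implicit Arguments.
Unset Strict Implicit.
Unset Printing Implicit Defensive.

Import Order.TTheory GRing.Theory Num.Theory.
Local Open Scope ring_scope.

(* Functions on [a, b] (resp. [0, b - a]) are represented by total functions
   R -> R; only their values on that interval are ever constrained or used. *)

Definition nneg_on_lengths (R : realType) (a b : R) (phi : R -> R) : Prop :=
  forall u : R, u \in `[0, b - a] -> 0 <= phi u.

Definition phi_convex (R : realType) (a b : R) (phi f : R -> R) : Prop :=
  nneg_on_lengths a b phi /\
  forall x y t : R, x \in `[a, b] -> y \in `[a, b] -> t \in `[0, 1] ->
    t * f x + (1 - t) * f y
      + t * phi ((1 - t) * `|x - y|) + (1 - t) * phi (t * `|x - y|)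
    >= f (t * x + (1 - t) * y).

Definition uniformly_convex (R : realType) (a b : R) (Phi f : R -> R) : Prop :=
  nneg_on_lengths a b Phi /\
  forall x y t : R, x \in `[a, b] -> y \in `[a, b] -> t \in `[0, 1] ->
    t * f x + (1 - t) * f y
    >= f (t * x + (1 - t) * y) + t * (1 - t) * Phi `|x - y|.

(* The points and weights x_1, ..., x_n and nu_1, ..., nu_n are the values at
   1, ..., n of functions nat -> R; other values are irrelevant.  The weights
   have total mass 1: without this normalization the inequalities already fail
   for constant f and zero error function. *)
Definition admissible (R : realType) (a b : R) (n : nat) (nu x : nat -> R) :
    Prop :=
  [/\ forall i : nat, (1 <= i <= n)%N -> x i \in `]a, b[,
      1 <= nu n,
      forall i : nat, (1 <= i < n)%N -> nu i <= 0,
      \sum_(1 <= i < n.+1) nu i = 1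
    & \sum_(1 <= i < n.+1) nu i * x i \in `]a, b[].

(* Main.v *)
Require Import Defs.
From mathcomp Require Import all_boot all_order all_algebra.
From mathcomp Require Import reals classical_sets.
From mathcomp Require Import ring lra.

(** Put [y = \sum_i nu_i x_i] and [p = x_n].  Solving for [p] writes it as a
    genuine convex combination of [y] and [x_1, ..., x_(n-1)]:

      [nu_n p = y + \sum_(i < n) (- nu_i) x_i],  [nu_n = 1 + \sum_(i < n) (- nu_i)],

    with nonnegative coefficients.  Both general inequalities are therefore
    Jensen inequalities at [p], and Jensen at [p] follows from a single affine
    function of value [f p] at [p] that stays below a suitable [g] on [[a, b]]
    ([reversed_jensen]); here [g z = f z + phi |z - p|] in the first part and
    [g z = f z - Phi |z - p|] in the second.

    Such a line exists as soon as the two-point inequality at [p] holds for [g]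
    ([supporting_line]): the slopes seen to the left of [p] are then bounded by
    those seen to the right, and since [p] is interior both families are
    nonempty, so the supremum of the left slopes is a real number that works.

    For a phi-convex [f] the two-point inequality for [g] is the definition,
    because the distances from [t x + (1 - t) y] to [x] and [y] are
    [(1 - t) |x - y|] and [t |x - y|].  For a uniformly convex [f] the two-point
    inequality for [f - Phi |. - p|] cannot be read off the definition: it would
    involve [Phi] at the distances to [p], while the definition only gives its
    value at [|x - y|], and [Phi] need not be monotone or optimal.  Instead a
    supporting line of the convex function [f] itself is taken, and uniform
    convexity on the segment from [p] to [z], near [p], lifts [f] above it by [Phi |z - p|]
    ([uniformly_convex_support]).

    The two-point case of the second part is of a different nature: it is the
    definition of uniform convexity on the segment from [y] to [x_1], on which
    [x_2] lies with parameter [1 / nu_2]. *)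

Set Implicit Arguments.
Unset Strict Implicit.
Unset Printing Implicit Defensive.

Import Order.TTheory GRing.Theory Num.Theory.
Local Open Scope ring_scope.

(** * Supporting lines *)

(** The hypothesis [hg] is the inequality between left and right slopes cleared
    of denominators, so that it can be checked without dividing. *)
Lemma supporting_line (R : realType) (a b p v : R) (g : R -> R) :
  a < p -> p < b -> v <= g p ->
  (forall x y, a <= x -> x < p -> p < y -> y <= b ->
     (y - x) * v <= (y - p) * g x + (p - x) * g y) ->
  exists c : R, forall z, a <= z <= b -> v + c * (z - p) <= g z.
Proof.
move=> ap pb hp hg.
pose S := [set s | exists2 x, a <= x < p & s = (v - g x) / (p - x)]%classic.
have left_le_right y : p < y -> y <= b -> ubound S ((g y - v) / (y - p)).
  move=> py yb s [x /andP[ax xp] ->].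
  have h := hg x y ax xp py yb.
  by rewrite ler_pdivrMr ?subr_gt0// mulrAC ler_pdivlMr ?subr_gt0//; nra.
have supS : has_sup S.
  split; first by exists ((v - g a) / (p - a)), a; rewrite ?lexx.
  by exists ((g b - v) / (b - p)); exact: left_le_right.
exists (sup S) => z /andP[az zb].
have [zp|pz|->] := ltgtP z p; last by rewrite subrr mulr0 addr0.
- have : (v - g z) / (p - z) <= sup S.
    by apply: ub_le_sup; [exact: supS.2|exists z; rewrite ?az].
  by rewrite ler_pdivrMr ?subr_gt0//; nra.
- have : sup S <= (g z - v) / (z - p).
    by apply: ge_sup; [exact: supS.1|exact: left_le_right].
  by rewrite ler_pdivlMr ?subr_gt0//; nra.
Qed.

(** Weigh the affine bound with [1] at [y = \sum_i nu_i x_i] and with [- nu_i]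
    at [x_i]: the total mass is [nu_n] and the linear terms cancel. *)
Lemma reversed_jensen (R : realType) (a b v c : R) (n : nat) (nu x : nat -> R)
    (g : R -> R) :
  (0 < n)%N -> admissible a b n nu x ->
  (forall z, a <= z <= b -> v + c * (z - x n) <= g z) ->
  nu n * v + \sum_(1 <= i < n) nu i * g (x i)
    <= g (\sum_(1 <= i < n.+1) nu i * x i).
Proof.
move=> n0 [hx _ hnu].
rewrite !big_nat_recr//=; set y := (X in X \in _) => sum1 /itvP hy hg.
have gy : v + c * (y - x n) <= g y by apply: hg; rewrite !hy.
have le_sum : \sum_(1 <= i < n) nu i * g (x i)
    <= \sum_(1 <= i < n) ((v - c * x n) * nu i + c * (nu i * x i)).
  apply: ler_sum_nat => i /andP[i1 ilt].
  have /itvP hxi : x i \in `]a, b[ by apply: hx; rewrite i1 ltnW.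
  have hgi : v + c * (x i - x n) <= g (x i) by apply: hg; rewrite !hxi.
  by have := hnu i; rewrite i1 ilt => /(_ isT); nra.
move: le_sum; rewrite big_split /= -!mulr_sumr => le_sum.
apply: le_trans gy; apply: le_trans (lerD (lexx _) le_sum) _.
rewrite /y; set N := \sum_(1 <= i < n) nu i in sum1 *.
have -> : nu n = 1 - N by rewrite -sum1 addrAC subrr add0r.
by rewrite le_eqVlt; apply/orP; left; apply/eqP; ring.
Qed.

(** * Supporting lines from generalized convexity *)

Lemma phi_convex_support (R : realType) (a b p : R) (phi f : R -> R) :
  p \in `]a, b[ -> phi_convex a b phi f ->
  exists c : R, forall z, a <= z <= b ->
    f p + c * (z - p) <= f z + phi `|z - p|.
Proof.
move=> /itvP hp [phi0 hf].
apply: (@supporting_line R a b p (f p) (fun z => f z + phi `|z - p|)).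
- by rewrite hp.
- by rewrite hp.
- rewrite subrr normr0 lerDl phi0// in_itv/= lexx subr_ge0.
  by rewrite (le_trans (y := p))// hp.
move=> x y ax xp py yb; have xy : 0 < y - x by lra.
pose t := (y - p) / (y - x).
have ht : t * (y - x) = y - p by rewrite /t divfK// gt_eqF.
have ht' : (1 - t) * (y - x) = p - x by rewrite mulrBl ht; ring.
have tI : t \in `[0, 1].
  rewrite in_itv/=; apply/andP.
  by split; rewrite /t ?ler_pdivrMr// ?divr_ge0//; lra.
have := hf x y t; rewrite !in_itv/= => /(_ _ _ tI).
have -> : t * x + (1 - t) * y = p by lra.
rewrite (distrC x y) (gtr0_norm xy) ht ht' => hxy.
rewrite (distrC x p) !gtr0_norm ?subr_gt0// -ht -ht' in hxy *.
have {}hxy : f p <= t * f x + (1 - t) * f y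
    + t * phi ((1 - t) * (y - x)) + (1 - t) * phi (t * (y - x)).
  by apply: hxy; apply/andP; split; lra.
by nra.
Qed.

(** A supporting line of slope [c] for [f], compared with uniform convexity at
    [t z + (1 - t) p], gives [(1 - t) Phi |z - p| <= f z - f p - c (z - p)] for
    every [t] in [(0, 1)]; letting [t] tend to [0] gives the claim. *)
Lemma uniformly_convex_support (R : realType) (a b p : R) (Phi f : R -> R) :
  p \in `]a, b[ -> uniformly_convex a b Phi f ->
  exists c : R, forall z, a <= z <= b ->
    f p + c * (z - p) <= f z - Phi `|z - p|.
Proof.
move=> /itvP hp [Phi0 hf].
have ap : a < p by rewrite hp.
have pb : p < b by rewrite hp.
have norm_len x y : a <= x <= b -> a <= y <= b -> 0 <= Phi `|x - y|.
  move=> /andP[ax xb] /andP[ay yb]; apply: Phi0.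
  by rewrite in_itv/= normr_ge0/= ler_norml; apply/andP; split; lra.
have [c hc] : exists c : R, forall z, a <= z <= b -> f p + c * (z - p) <= f z.
  apply: supporting_line => // x y ax xp py yb; have xy : 0 < y - x by lra.
  pose t := (y - p) / (y - x).
  have ht : t * (y - x) = y - p by rewrite /t divfK// gt_eqF.
  have ht' : (1 - t) * (y - x) = p - x by rewrite mulrBl ht; ring.
  have /andP[t0 t1] : 0 <= t <= 1.
    by apply/andP; split; rewrite /t ?ler_pdivrMr// ?divr_ge0//; lra.
  have xI : a <= x <= b by apply/andP; split; lra.
  have yI : a <= y <= b by apply/andP; split; lra.
  have := hf x y t; rewrite !in_itv/= t0 t1 => /(_ xI yI isT).
  have -> : t * x + (1 - t) * y = p by lra.
  have := mulr_ge0 (mulr_ge0 t0 (_ : 0 <= 1 - t)) (norm_len x y xI yI).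
  rewrite subr_ge0 => /(_ t1) h0 h1.
  have {h0 h1} : f p <= t * f x + (1 - t) * f y by lra.
  by rewrite -ht -ht'; nra.
exists c => z zI; have := norm_len z p zI; rewrite (ltW ap) (ltW pb) => /(_ isT).
set P := Phi _ => P0; set K := f z - f p - c * (z - p).
have key t : 0 < t -> t < 1 -> (1 - t) * P <= K.
  move=> t0 t1; have /andP[az zb] := zI.
  have tI : a <= t * z + (1 - t) * p <= b by apply/andP; split; nra.
  have := hf z p t; rewrite !in_itv/= zI (ltW ap) (ltW pb) (ltW t0) (ltW t1).
  move=> /(_ isT isT isT); rewrite -/P => h; have := hc _ tI => h'.
  by rewrite -(ler_pM2l t0) /K; nra.
suff : P <= K by rewrite /K; lra.
rewrite leNgt; apply/negP => KP.
have K0 : 0 <= K by have := key (2^-1); lra.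
have Pgt0 : 0 < P by lra.
(* With this [t], [(1 - t) * P] is the midpoint of [K] and [P]. *)
pose t := (P - K) / (2 * P).
have tP : t * P = (P - K) / 2 by rewrite /t; field; rewrite gt_eqF.
have t0 : 0 < t by rewrite /t divr_gt0//; lra.
have t1 : t < 1 by rewrite /t ltr_pdivrMr; lra.
by have := key t t0 t1; lra.
Qed.

(** * The inequalities *)

Lemma phi_convex_reversed_jensen (R : realType) (a b : R) (phi f : R -> R)
    (n : nat) (nu x : nat -> R) :
  phi_convex a b phi f -> (0 < n)%N -> admissible a b n nu x ->
  \sum_(1 <= i < n.+1) nu i * f (x i)
    - phi `|\sum_(1 <= i < n.+1) nu i * x i - x n|
    + \sum_(1 <= i < n) nu i * phi `|x i - x n|
  <= f (\sum_(1 <= i < n.+1) nu i * x i).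
Proof.
move=> hf n0 adm; have [hx _ _ _ _] := adm.
have [|c hc] := phi_convex_support _ hf (p := x n); first by rewrite hx// n0/=.
have := reversed_jensen n0 adm hc.
under eq_bigr do rewrite mulrDr.
by rewrite big_split/= (big_nat_recr _ _ (fun i => nu i * f (x i)))//=; lra.
Qed.

Lemma uniformly_convex_reversed_jensen (R : realType) (a b : R)
    (Phi f : R -> R) (n : nat) (nu x : nat -> R) :
  uniformly_convex a b Phi f -> (0 < n)%N -> admissible a b n nu x ->
  \sum_(1 <= i < n.+1) nu i * f (x i)
    + Phi `|\sum_(1 <= i < n.+1) nu i * x i - x n|
    - \sum_(1 <= i < n) nu i * Phi `|x i - x n|
  <= f (\sum_(1 <= i < n.+1) nu i * x i).
Proof.
move=> hf n0 adm; have [hx _ _ _ _] := adm.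
have [|c hc] := uniformly_convex_support _ hf (p := x n).
  by rewrite hx// n0/=.
have := reversed_jensen n0 adm hc.
under eq_bigr do rewrite mulrBr.
by rewrite sumrB/= (big_nat_recr _ _ (fun i => nu i * f (x i)))//=; lra.
Qed.

Lemma uniformly_convex_extrapolation (R : realType) (a b : R) (Phi f : R -> R)
    (nu1 nu2 x1 x2 : R) :
  uniformly_convex a b Phi f -> x1 \in `[a, b] -> nu1 <= 0 ->
  nu1 + nu2 = 1 -> nu1 * x1 + nu2 * x2 \in `[a, b] ->
  nu1 * f x1 + nu2 * f x2 - nu1 / nu2 * Phi (nu2 * `|x2 - x1|)
    <= f (nu1 * x1 + nu2 * x2).
Proof.
move=> [_ hf] hx1 nu1_le0 sum1; set y := nu1 * x1 + nu2 * x2 => hy.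
have nu2_gt0 : 0 < nu2 by lra.
have nu2_neq0 : nu2 != 0 by rewrite gt_eqF.
have e1 : nu1 = 1 - nu2 by lra.
have tI : nu2^-1 \in `[0, 1].
  by rewrite in_itv/= invr_ge0 (ltW nu2_gt0)/= invf_le1//; lra.
have := hf y x1 _ hy hx1 tI.
have -> : nu2^-1 * y + (1 - nu2^-1) * x1 = x2.
  by rewrite /y e1; field.
have -> : `|y - x1| = nu2 * `|x2 - x1|.
  by rewrite -[in RHS](gtr0_norm nu2_gt0) -normrM /y e1; congr `|_|; ring.
set P := Phi _; rewrite -(ler_pM2l nu2_gt0).
have -> : nu2 * (f x2 + nu2^-1 * (1 - nu2^-1) * P)
    = nu2 * f x2 - nu1 / nu2 * P by rewrite e1; field.
have -> : nu2 * (nu2^-1 * f y + (1 - nu2^-1) * f x1) = f y - nu1 * f x1.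
  by rewrite e1; field.
by lra.
Qed.

Theorem theorem10 (R : realType) (a b : R) (f phi Phi : R -> R)
    (hab : a < b)
    (hphi : nneg_on_lengths a b phi) (hPhi : nneg_on_lengths a b Phi) :
  (phi_convex a b phi f ->
    (forall (n : nat) (nu x : nat -> R), (0 < n)%N ->
       admissible a b n nu x ->
       f (\sum_(1 <= i < n.+1) nu i * x i) >=
         \sum_(1 <= i < n.+1) nu i * f (x i)
         - phi `|\sum_(1 <= i < n.+1) nu i * x i - x n|
         + \sum_(1 <= i < n) nu i * phi `|x i - x n|) /\
    (forall nu x1 x2 : R,
       x1 \in `]a, b[ -> x2 \in `]a, b[ -> 1 <= nu ->
       (1 - nu) * x1 + nu * x2 \in `]a, b[ ->
       (1 - nu) * f x1 + nu * f x2 <=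
         f ((1 - nu) * x1 + nu * x2)
         - (1 - nu) * phi `|x1 - x2|
         + phi ((nu - 1) * `|x1 - x2|))) /\
  (uniformly_convex a b Phi f ->
    (forall (n : nat) (nu x : nat -> R), (0 < n)%N ->
       admissible a b n nu x ->
       f (\sum_(1 <= i < n.+1) nu i * x i) >=
         \sum_(1 <= i < n.+1) nu i * f (x i)
         + Phi `|\sum_(1 <= i < n.+1) nu i * x i - x n|
         - \sum_(1 <= i < n) nu i * Phi `|x i - x n|) /\
    (forall nu1 nu2 x1 x2 : R,
       x1 \in `]a, b[ -> x2 \in `]a, b[ -> nu1 <= 0 -> 1 <= nu2 ->
       nu1 + nu2 = 1 ->
       nu1 * x1 + nu2 * x2 \in `]a, b[ ->
       f (nu1 * x1 + nu2 * x2) >=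
         nu1 * f x1 + nu2 * f x2
         - nu1 / nu2 * Phi (nu2 * `|x2 - x1|))).
Proof.
split=> hf; split; first by move=> n nu x; exact: phi_convex_reversed_jensen hf.
- move=> nu x1 x2 hx1 hx2 nu_ge1 hy.
  pose w i : R := if i == 1%N then 1 - nu else nu.
  pose x i := if i == 1%N then x1 else x2.
  have sum2 (F : nat -> R) : \sum_(1 <= i < 3) F i = F 1%N + F 2%N.
    by rewrite big_nat_recr//= big_nat1.
  have adm : admissible a b 2 w x.
    split; rewrite ?sum2 /w/= ?subrK//.
    - by move=> i _; rewrite /x; case: ifP.
    - by move=> [|[|i]]//= _; lra.
  have := phi_convex_reversed_jensen hf (isT : (0 < 2)%N) adm.
  rewrite !sum2 big_nat1 /w /x/=.
  have -> : (1 - nu) * x1 + nu * x2 - x2 = (nu - 1) * (x2 - x1) by ring.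
  by rewrite normrM (distrC x2 x1) ger0_norm ?subr_ge0//; lra.
- by move=> n nu x; exact: uniformly_convex_reversed_jensen hf.
- move=> nu1 nu2 x1 x2 hx1 _ nu1_le0 _ sum1 hy.
  apply: (uniformly_convex_extrapolation hf) => //.
    exact: subset_itv_oo_cc hx1.
  exact: subset_itv_oo_cc hy.
Qed.
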